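(* Assume there are constants $\gamma_t\ge 0$ ($t=0,\dots,T-1$) with $|C_t(x)-C_t(y)|\le\gamma_t|x-y|$ for all $x,y$. For every $t=0,1,\dots,T-2$ and every $x$ with $z_{k-1}<x\le z_k$, $z_k\in Z_\theta$: $\epsilon_t(x)\le\bar\epsilon_t(z_k)$.
   Context: Model. Fix an integer horizon $T\ge 2$, a discount factor $\alpha\in(0,1]$, and for $t=0,\dots,T-1$: unit ordering costs $c_t\in\mathbb R$, a salvage coefficient $c_T\in\mathbb R$, setup costs $K_t\ge 0$, functions $G_t:\mathbb R\to\mathbb R$, and independent nonnegative random demands $D_0,\dots,D_{T-1}$ with right-continuous distribution functions $F_t$ and finite means; all expectations appearing are assumed finite. Put $C_t(y)=(c_t-\alpha c_{t+1})y+G_t(y)+\alpha c_{t+1}E[D_t]$. Standing assumptions: (i) each $C_t$ is convex with $C_t(y)\to+\infty$ as $|y|\to\infty$; (ii) $K_t\ge \alpha K_{t+1}$ for $t=0,\dots,T-2$. Grid construction. Fix $\theta>0$, $z_m=m\theta$, $Z_\theta=\{z_m:m\in\mathbb Z\}$, $f_t(n)=F_t(z_{n+1})-F_t(z_n)$ ($n\ge -1$). $C^m_t=\min\{y: C_t(y)=\min_x C_t(x)\}$; with $z_{n_0}<C^m_t\le z_{n_0+1}$, $S^U_t=\min\{z_m\in Z_\theta: z_m\ge C^m_t,\ C_t(z_m)>C_t(z_{n_0})+K_t\}$. $s_{T-1}$ is a point with $s_{T-1}\le C^m_{T-1}$, $C_{T-1}(s_{T-1})=C_{T-1}(C^m_{T-1})+K_{T-1}$;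 $\bar I_{T-1}=s_{T-1}$. For $t=T-2,\dots,0$: $I_t=\max\{z_m\in Z_\theta: z_m<\min(\bar I_{t+1}-\theta,C^m_t)\}$, $\bar I_t=\max\{z_m\in Z_\theta: z_m\le I_t,\ C_t(z_m)>C_t(I_t)+K_t\}+\theta$. $H_{T-1}=C_{T-1}$, $S_{T-1}=C^m_{T-1}$; $V_t(y)=H_t(S_t)+K_t$ for $y<s_t$, $V_t(y)=H_t(y)$ for $y\ge s_t$. For $t=T-2,\dots,0$: $H_t(y)=C_t(y)+\alpha\sum_{n=-1}^\infty V_{t+1}(y-z_n)f_t(n)$; $S_t=\max\{z_m\in Z_\theta: I_t\le z_m\le S^U_t,\ H_t(z_m)=\min\{H_t(z_n):z_n\in Z_\theta, I_t\le z_n\le S^U_t\}\}$; $s_t=S_t$ if $K_t=0$, else $s_t=\min\{z_m\in Z_\theta:\bar I_t\le z_m\le S_t,\ H_t(z_m)\le H_t(S_t)+K_t\}$. Error terms. For $t=1,\dots,T-1$, $A_t(x)=E[V_t(x-D_{t-1})]-\sum_{n=-1}^{\infty}V_t(x-z_n)f_{t-1}(n)$. $\epsilon_{T-1}\equiv 0$; for $t=0,\dots,T-2$: $\epsilon_t(x)=\alpha A_{t+1}(S_t)+\alpha E[\epsilon_{t+1}(S_t-D_t)]$ if $x<s_t$, and $\epsilon_t(x)=\alpha A_{t+1}(x)+\alpha E[\epsilon_{t+1}(x-D_t)]$ if $x\ge s_t$. Upper estimate functions. $\bar\psi_{T-1}(x,y)=\gamma_{T-1}x$; $\bar\varphi_{T-1}(x,y)=0$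 if $y<s_{T-1}$ and $=\gamma_{T-1}x$ if $y\ge s_{T-1}$. For $t=0,\dots,T-2$, with $n$ the integer such that $z_{n-1}\le y-s_{t+1}<z_n$: $\bar\psi_t(x,y)=\gamma_tx$ if $y<s_{t+1}-\theta$, else $\bar\psi_t(x,y)=\gamma_tx+\alpha\sum_{m=-1}^{n-1}\bar\varphi_{t+1}(x,y-z_m)f_t(m)$; $\bar\varphi_t(x,y)=0$ if $y<s_t$, $=\bar\psi_t(y-s_t+\theta,y)$ if $y\ge s_t$ and $y-x<s_t$, $=\bar\psi_t(x,y)$ if $y\ge s_t$ and $y-x\ge s_t$. Bound $\bar\epsilon$. For $z_k\in Z_\theta$: $\bar\epsilon_{T-2}(z_k)=\alpha\gamma_{T-1}\theta$, and for $t=0,\dots,T-3$, $\bar\epsilon_t(z_k)=\alpha^{T-1-t}\gamma_{T-1}\theta+\sum_{i=0}^{T-3-t}2\alpha^i\big[\bar\psi_{t+i}(\theta,\max(\lambda_t(i),S_{t+i}))-\gamma_{t+i}\theta\big]$, where $\lambda_t(0)=z_k$ and $\lambda_t(i)=\max(\lambda_t(i-1),S_{t+i-1})+\theta$ for $i=1,\dots,T-3-t$. *)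

(* Defs.v *)
From mathcomp Require Import all_boot all_order all_algebra.
From mathcomp Require Import all_classical all_reals all_analysis.
Import Order.TTheory GRing.Theory Num.Theory.
Import numFieldNormedType.Exports.
Set Implicit Arguments. Unset Strict Implicit. Unset Printing Implicit Defensive.
Local Open Scope classical_set_scope.
Local Open Scope ring_scope.

(* Data of the inventory model.  The demand D_t is represented by its law
   [mu t] (a probability measure on the reals); F_t(x) = mu_t(]-oo,x]).  *)
Record model (R : realType) := Model {
  T : nat;                        (* horizon *)
  alpha : R;                      (* discount factor *)
  theta : R;                      (* grid step *)
  c : nat -> R;                   (* c_0..c_{T-1} unit costs, c_T salvage *)
  K : nat -> R;                   (* setup costs *)
  G : nat -> R -> R;
  mu : nat -> probability R R
}.

Section Model.
Variable R : realType.
Variable M : model R.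
Variable sTm1 : R.
Variable gamma : nat -> R.

Local Notation T := (T M).
Local Notation alpha := (alpha M).
Local Notation theta := (theta M).
Local Notation c := (c M).
Local Notation K := (K M).
Local Notation G := (G M).
Local Notation mu := (mu M).

Definition z (m : int) : R := theta * m%:~R.

Definition F (t : nat) (x : R) : R := fine (mu t `]-oo, x]%classic).
Definition f (t : nat) (n : int) : R := F t (z (n + 1)) - F t (z n).

Definition expect (t : nat) (g : R -> R) : R := fine (\int[mu t]_d (g d)%:E)%E.

Definition series_m1 (a : int -> R) : R :=
  limn (series (fun k : nat => a (k%:Z - 1))).

Definition gridmax (P : R -> Prop) : R := sup [set x | exists m, x = z m /\ P x].
Definition gridmin (P : R -> Prop) : R := inf [set x | exists m, x = z m /\ P x].

Definition C (t : nat) (y : R) : R :=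
  (c t - alpha * c t.+1) * y + G t y + alpha * c t.+1 * expect t id.

Definition Cm (t : nat) : R := inf [set y | forall x, C t y <= C t x].

Definition zn0 (t : nat) : R := gridmax (fun x => x < Cm t).

Definition SU (t : nat) : R :=
  gridmin (fun x => Cm t <= x /\ C t (zn0 t) + K t < C t x).

Record stage := Stage { sH : R -> R; sS : R; ss : R; sIbar : R }.

Definition Vof (st : stage) (Kt : R) (y : R) : R :=
  if y < ss st then sH st (sS st) + Kt else sH st y.

(* stg k = data of stage t = T-1-k *)
Fixpoint stg (k : nat) : stage :=
  match k with
  | 0 => Stage (C T.-1) (Cm T.-1) sTm1 sTm1
  | k'.+1 =>
    let t := (T.-1 - k)%N in
    let nx := stg k' in
    let V := Vof nx (K t.+1) in
    let H := fun y => C t y + alpha * series_m1 (fun n => V (y - z n) * f t n) in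
    let I := gridmax (fun x => x < Order.min (sIbar nx - theta) (Cm t)) in
    let Ib := gridmax (fun x => x <= I /\ C t I + K t < C t x) + theta in
    let S := gridmax (fun x => I <= x <= SU t /\
               H x = inf [set v | exists n, I <= z n <= SU t /\ v = H (z n)]) in
    let s := if K t == 0 then S
             else gridmin (fun x => Ib <= x <= S /\ H x <= H S + K t) in
    Stage H S s Ib
  end.

Definition stage_at (t : nat) : stage := stg (T.-1 - t).
Definition H (t : nat) : R -> R := sH (stage_at t).
Definition S (t : nat) : R := sS (stage_at t).
Definition s (t : nat) : R := ss (stage_at t).
Definition Ibar (t : nat) : R := sIbar (stage_at t).
Definition V (t : nat) (y : R) : R := Vof (stage_at t) (K t) y.

(* A_t(x), t >= 1 *)
Definition A (t : nat) (x : R) : R :=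
  expect t.-1 (fun d => V t (x - d)) - series_m1 (fun n => V t (x - z n) * f t.-1 n).

(* epsk k = epsilon_{T-1-k} *)
Fixpoint epsk (k : nat) : R -> R :=
  match k with
  | 0 => fun _ => 0
  | k'.+1 =>
    let t := (T.-1 - k)%N in
    fun x => let y := if x < s t then S t else x in
      alpha * A t.+1 y + alpha * expect t (fun d => epsk k' (y - d))
  end.

Definition eps (t : nat) : R -> R := epsk (T.-1 - t).

Definition psi_of (t : nat) (phin : R -> R -> R) (x y : R) : R :=
  if y < s t.+1 - theta then gamma t * x
  else
    let n := Num.floor ((y - s t.+1) / theta) + 1 in
    (* n is the integer with z_{n-1} <= y - s_{t+1} < z_n;
       the sum is over m = j - 1 = -1, ..., n - 1 *)
    gamma t * x + alpha * \sum_(0 <= j < absz (n + 1))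
                           phin x (y - z (j%:Z - 1)) * f t (j%:Z - 1).

Definition phi_of (t : nat) (psi : R -> R -> R) (x y : R) : R :=
  if y < s t then 0
  else if y - x < s t then psi (y - s t + theta) y
  else psi x y.

(* phik k = phibar_{T-1-k} *)
Fixpoint phik (k : nat) : R -> R -> R :=
  match k with
  | 0 => fun x y => if y < s T.-1 then 0 else gamma T.-1 * x
  | k'.+1 => let t := (T.-1 - k)%N in phi_of t (psi_of t (phik k'))
  end.

Definition phibar (t : nat) : R -> R -> R := phik (T.-1 - t).
Definition psibar (t : nat) : R -> R -> R :=
  if t == T.-1 then fun x _ => gamma t * x else psi_of t (phibar t.+1).

Fixpoint lam (t : nat) (zk : R) (i : nat) : R :=
  match i with
  | 0 => zk
  | i'.+1 => Order.max (lam t zk i') (S (t + i')) + theta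
  end.

Definition epsbar (t : nat) (zk : R) : R :=
  if t == (T - 2)%N then alpha * gamma T.-1 * theta
  else alpha ^+ (T.-1 - t) * gamma T.-1 * theta
       + \sum_(0 <= i < T - 2 - t)
           2 * alpha ^+ i * (psibar (t + i) theta (Order.max (lam t zk i) (S (t + i)))
                             - gamma (t + i) * theta).

End Model.

(* Main.v *)
Require Import Defs.
From mathcomp Require Import all_boot all_order all_algebra.
From mathcomp Require Import all_classical all_reals all_analysis.
From mathcomp Require Import zify ring lra.
Set Implicit Arguments.
Unset Strict Implicit.
Unset Printing Implicit Defensive.
Import Order.TTheory GRing.Theory Num.Theory.
Import numFieldNormedType.Exports.
Local Open Scope classical_set_scope.
Local Open Scope ring_scope.

(** On the grid, [phibar_t (theta, z_j)] vanishes below [s_t] and equals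
[psibar_t (theta, z_j)] above it.  By descending induction on [t], the cost
[V_t] rises by at most [2 phibar_t (theta, z_j)] when the inventory drops from
[y] to [y'], whenever [z_{j-2} <= y' <= y <= z_j]; the step crossing [s_t] uses
[H_t S_t + K_t <= H_t (s_t - theta)], which holds because [s_t] is the least
admissible grid point, or because all the points at which [V_{t+1}] is evaluated
lie below [s_{t+1}], where it is constant, so that [H_t] varies as [C_t].
Rounding a demand to the grid moves the inventory by at most [theta], hence
[alpha A_{t+1}(y) <= 2 (psibar_t (theta, z_j) - gamma_t theta)] for
[z_{j-1} <= y <= z_j].  The right-hand side increases with [j], so summing over
the stages gives [epsbar].  The sums defining [H_t] and [A_t] are computed from
the fact that [V_{t+1}(y - z_n)] is constant for large [n]. *)

(** * Extremal integers and extremal grid points *)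

Lemma int_max_ex (P : int -> Prop) (b : int) :
  (exists m, P m) -> (forall m, P m -> m <= b) ->
  exists m, P m /\ forall n, P n -> n <= m.
Proof.
move=> [m0 Pm0] Pb.
have ex : exists k : nat, `[< P (b - k%:Z) >].
  exists `|b - m0|%N; apply/asboolP.
  by have := Pb _ Pm0; rewrite -subr_ge0 => /gez0_abs ->; rewrite subKr.
have [k /asboolP Pk kmin] := ex_minnP ex.
exists (b - k%:Z); split=> // n Pn.
have nb := Pb _ Pn.
have /kmin : `[< P (b - `|b - n|%N%:Z) >].
  by apply/asboolP; rewrite gez0_abs ?subr_ge0// subKr.
lia.
Qed.

Lemma int_min_ex (P : int -> Prop) (b : int) :
  (exists m, P m) -> (forall m, P m -> b <= m) ->
  exists m, P m /\ forall n, P n -> m <= n.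
Proof.
move=> [m0 Pm0] Pb.
have [||m [Pm mmax]] := @int_max_ex (fun n => P (- n)) (- b).
- by exists (- m0); rewrite opprK.
- by move=> m /Pb; lia.
- by exists (- m); split=> // n Pn; have := mmax (- n); rewrite opprK => /(_ Pn); lia.
Qed.

Section Grid.
Variables (R : realType) (M : model R).
Hypothesis th0 : 0 < theta M.
Local Notation th := (theta M).
Local Notation z := (z M).

Lemma zD m n : z (m + n) = z m + z n.
Proof. by rewrite /Defs.z intrD mulrDr. Qed.

Lemma zB m n : z (m - n) = z m - z n.
Proof. by rewrite /Defs.z intrB mulrBr. Qed.

Lemma z1 : z 1 = th. Proof. by rewrite /Defs.z mulr1. Qed.

Lemma z0 : z 0 = 0. Proof. by rewrite /Defs.z mulr0. Qed.

Lemma z_le m n : (z m <= z n) = (m <= n).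
Proof. by rewrite /Defs.z ler_pM2l// ler_int. Qed.

Lemma z_lt m n : (z m < z n) = (m < n).
Proof. by rewrite /Defs.z ltr_pM2l// ltr_int. Qed.

Lemma z_ceil x : exists m, z (m - 1) < x <= z m.
Proof.
exists (Num.ceil (x / th)); have := ceil_itv (x / th); rewrite /Defs.z.
by rewrite ltr_pdivlMr// ler_pdivrMr// ![_ * th]mulrC.
Qed.

Lemma z_unbounded x : exists N : nat, forall n : int, N%:Z <= n -> x < z n.
Proof.
have [m /andP[_ xm]] := z_ceil x.
exists `|m|.+1 => n mn; apply: (le_lt_trans xm).
rewrite z_lt; lia.
Qed.

(** The grid is discrete, so [sup] is attained; nonemptiness and boundedness keep it away from its
    default value. *)
Lemma gridmaxP (P : R -> Prop) :
  (exists m, P (z m)) -> (exists b, forall m, P (z m) -> z m <= b) ->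
  exists m, [/\ gridmax M P = z m, P (z m) & forall n, P (z n) -> n <= m].
Proof.
move=> exP [b Pb]; have [B /andP[_ bB]] := z_ceil b.
have [||m [Pm mmax]] := @int_max_ex (fun n => P (z n)) B => //.
  by move=> m /Pb mb; rewrite -z_le (le_trans mb).
exists m; split=> //; apply/le_anti/andP; split.
  apply: ge_sup; first by exists (z m), m.
  by move=> _ [n [-> /mmax]]; rewrite z_le.
apply: ub_le_sup; last by exists m.
by exists (z m) => _ [n [-> /mmax]]; rewrite z_le.
Qed.

Lemma gridminP (P : R -> Prop) :
  (exists m, P (z m)) -> (exists b, forall m, P (z m) -> b <= z m) ->
  exists m, [/\ gridmin M P = z m, P (z m) & forall n, P (z n) -> m <= n].
Proof.
move=> exP [b Pb]; have [B /andP[Bb _]] := z_ceil b.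
have [||m [Pm mmin]] := @int_min_ex (fun n => P (z n)) (B - 1) => //.
  by move=> m /Pb mb; rewrite -z_le (le_trans (ltW Bb)).
exists m; split=> //; apply/le_anti/andP; split.
  apply: ge_inf; last by exists m.
  by exists (z m) => _ [n [-> /mmin]]; rewrite z_le.
apply: lb_le_inf; first by exists (z m), m.
by move=> _ [n [-> /mmin]]; rewrite z_le.
Qed.

(** The range is finite, so the [inf] in the definition of [S] is an attained minimum, and
    [gridmaxP] applies to the points attaining it. *)
Lemma grid_argmax_argmin (h : R -> R) (a b : int) : a <= b ->
  exists m, gridmax M (fun x => z a <= x <= z b /\
       h x = inf [set v | exists n, z a <= z n <= z b /\ v = h (z n)]) = z m
    /\ [/\ a <= m, m <= b & forall n, a <= n <= b -> h (z m) <= h (z n)].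
Proof.
move=> ab.
have [m0 [m0ab m0min]] : exists m, a <= m <= b /\ forall n, a <= n <= b -> h (z m) <= h (z n).
  suff : forall k : nat, exists m, a <= m <= a + k%:Z /\
      forall n, a <= n <= a + k%:Z -> h (z m) <= h (z n).
    by move=> /(_ `|b - a|%N); rewrite gez0_abs ?subr_ge0// subrKC.
  elim=> [|k [m [mk mmin]]].
    exists a; split; first lia.
    by move=> n nk; have -> : n = a by lia.
  have [le|lt] := leP (h (z m)) (h (z (a + k.+1%:Z))).
    exists m; split; first lia.
    move=> n nk; have [->//|nk'] := eqVneq n (a + k.+1%:Z).
    by apply: mmin; lia.
  exists (a + k.+1%:Z); split; first lia.
  move=> n nk; have [->//|nk'] := eqVneq n (a + k.+1%:Z).
  by apply: (le_trans (ltW lt)); apply: mmin; lia.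
set I := inf _.
have hI : h (z m0) = I.
  apply/le_anti/andP; split.
    apply: lb_le_inf; first by exists (h (z m0)), m0; rewrite !z_le.
    by move=> _ [n [nab ->]]; apply: m0min; rewrite -!z_le.
  apply: ge_inf; last by exists m0; rewrite !z_le.
  by exists (h (z m0)) => _ [n [nab ->]]; apply: m0min; rewrite -!z_le.
have [||m [-> [mab hm] _]] := @gridmaxP (fun x => z a <= x <= z b /\ h x = I).
- by exists m0; rewrite !z_le.
- by exists (z b) => m [/andP[]].
move: mab; rewrite !z_le => /andP[am mb].
by exists m; split=> //; split=> // n nab; rewrite hm -hI m0min.
Qed.

End Grid.

(** * The law of one demand *)

Section Law.
Variables (R : realType) (M : model R).
Hypothesis th0 : 0 < theta M.
Local Notation th := (theta M).
Local Notation z := (z M).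
Variable t : nat.
Hypothesis mu_neg : mu M t `]-oo, 0[%classic = 0%E.

Lemma F_le x y : x <= y -> F M t x <= F M t y.
Proof.
move=> xy; apply: fine_le; rewrite ?fin_num_measure//.
apply: le_measure; rewrite ?inE//.
by apply: subset_itvl; rewrite bnd_simp.
Qed.

Lemma f_ge0 n : 0 <= f M t n.
Proof. by rewrite subr_ge0 F_le// z_le// lerDl. Qed.

Lemma F_neg x : x < 0 -> F M t x = 0.
Proof.
move=> x0; rewrite /F; suff -> : mu M t `]-oo, x]%classic = 0%E by [].
apply/eqP; rewrite -measure_le0 -mu_neg; apply: le_measure; rewrite ?inE//.
by apply: subset_itvl; rewrite bnd_simp.
Qed.

Lemma F_le1 x : F M t x <= 1.
Proof.
rewrite -[leRHS]/(fine 1%E); apply: fine_le; rewrite ?fin_num_measure//.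
exact: probability_le1.
Qed.

Lemma sum_f N : \sum_(0 <= k < N) f M t (k%:Z - 1) = F M t (z (N%:Z - 1)).
Proof.
(* The weights telescope, and the boundary term is [F] at [z (-1) = - theta < 0]. *)
rewrite (eq_bigr (fun k => F M t (z (k.+1%:Z - 1)) - F M t (z (k%:Z - 1)))); last first.
  by move=> k _; rewrite /f subrK -addn1 PoszD addrK.
rewrite (telescope_sumr (fun k => F M t (z (k%:Z - 1))))// [X in _ - X]F_neg ?subr0//.
by rewrite /Defs.z sub0r mulrN1 oppr_lt0.
Qed.

Lemma F_cvg : (F M t (z (N%:Z - 1)) @[N --> \oo] --> (1 : R)).
Proof.
have cov : \bigcup_(N : nat) `]-oo, z (N%:Z - 1)]%classic = setT.
  apply/seteqP; split=> // x _; have [N Nx] := z_unbounded th0 x.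
  exists N.+1 => //=; rewrite in_itv/=; apply/ltW/Nx; lia.
have : mu M t (\bigcup_(N : nat) `]-oo, z (N%:Z - 1)]%classic) = 1%E.
  by rewrite cov; exact: probability_setT.
move=> mu1; rewrite -[X in _ --> X]/(fine 1%E) -mu1; apply: fine_cvg.
rewrite fineK ?cov ?fin_num_measure// -cov.
apply: nondecreasing_cvg_mu => //; first by rewrite cov.
move=> m n mn; apply/subsetPset.
by apply: subset_itvl; rewrite bnd_simp z_le//; lia.
Qed.

(** Writing [v = c + (v - c)], the constant part contributes [c] because the weights [f] have total
    mass 1, and the rest has at most [N] nonzero terms. *)
Lemma series_evconst (v : int -> R) c N :
  (forall k : nat, (N <= k)%N -> v (k%:Z - 1) = c) ->
  series_m1 (fun n => v n * f M t n) =
  c + \sum_(0 <= k < N) (v (k%:Z - 1) - c) * f M t (k%:Z - 1).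
Proof.
move=> vc; rewrite /series_m1; apply/cvg_lim => //.
set X := \sum_(_ <= _ < _) _.
have h : (c * F M t (z (n%:Z - 1)) + X @[n --> \oo] --> c + X).
  apply: cvgD; last exact: cvg_cst.
  by rewrite -[X in _ --> X]mulr1; apply: cvgM; [exact: cvg_cst|exact: F_cvg].
apply: cvg_trans h; apply: near_eq_cvg; near=> n.
have Nn : (N <= n)%N by near: n; exact: nbhs_infty_ge.
have -> : X = \sum_(0 <= k < n) (v (k%:Z - 1) - c) * f M t (k%:Z - 1).
  rewrite (@big_cat_nat _ _ _ N)//= [X in _ = _ + X]big_nat_cond [X in _ = _ + X]big1 ?addr0//.
  by move=> k /andP[/andP[Nk _] _]; rewrite vc// subrr mul0r.
rewrite /series/= -sum_f mulr_sumr.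
by rewrite -big_split/=; apply: eq_bigr => k _; ring.
Unshelve. all: by end_near.
Qed.

Lemma expect_cst c : expect M t (fun=> c) = c.
Proof.
have mu1 : mu M t setT = 1%E := probability_setT (mu M t).
have -> : expect M t (fun=> c) = c * fine (mu M t setT) by exact: Rintegral_cst.
by rewrite mu1 mulr1.
Qed.

(** The negative half-line is a null set, so it can be removed from both integrals before they are
    compared. *)
Lemma expect_le g h :
  (mu M t).-integrable setT (EFin \o g) -> (mu M t).-integrable setT (EFin \o h) ->
  (forall d, 0 <= d -> g d <= h d) -> expect M t g <= expect M t h.
Proof.
pose N : set R := `]-oo, 0[%classic.
have mN : measurable (setT `\` N).
  apply: (@measurableD _ (measurableTypeR R) setT N); [exact: measurableT|exact: measurable_itv].
have onN u : (mu M t).-integrable setT (EFin \o u) ->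
    expect M t u = \int[mu M t]_(x in setT `\` N) u x.
  by move=> iu; rewrite /expect (negligible_integral _ _ iu mu_neg).
have inN u : (mu M t).-integrable setT (EFin \o u) ->
    (mu M t).-integrable (setT `\` N) (EFin \o u).
  by move=> iu; apply: integrableS iu.
move=> ig ih gh; rewrite !onN//; apply: le_Rintegral => //; try exact: inN.
move=> d [_]; rewrite /N/= in_itv/= => /negP; rewrite -leNgt; exact: gh.
Qed.

(** The cell from [z (k - 1)] to [z k] has mass [f t (k - 1)], so sums weighted by [f] are
    expectations of step functions; [A_le] compares the two terms of [A] in this way. *)
Lemma expect_step (w : nat -> R) N :
  let W := fun d => \sum_(0 <= k < N) w k * \1_(`]z (k%:Z - 1), z k%:Z]%classic) d in
  (mu M t).-integrable setT (EFin \o W) /\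
  expect M t W = \sum_(0 <= k < N) w k * f M t (k%:Z - 1).
Proof.
elim: N => [|N [iW eW]] /=.
  split.
    rewrite [X in _.-integrable _ X](_ : _ = EFin \o cst 0); last first.
      by apply/funext => d /=; rewrite big_nil.
    exact: finite_measure_integrable_cst.
  rewrite big_nil -[RHS](expect_cst 0); congr expect.
  by apply/funext => d; rewrite big_nil.
set A := `]z (N%:Z - 1), z N%:Z]%classic.
have iA : (mu M t).-integrable setT (EFin \o (\1_A : R -> R)).
  by apply: integrable_indic; exact: measurable_itv.
have iwA : (mu M t).-integrable setT (EFin \o (fun d => w N * \1_A d)).
  by apply: (integrableZl _ (w N) iA).
under [X in EFin \o X]eq_fun do rewrite big_nat_recr//=.
rewrite (_ : (fun d => \sum_(0 <= k < N.+1) _) = (fun d => 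
  \sum_(0 <= k < N) w k * \1_(`]z (k%:Z - 1), z k%:Z]%classic) d + w N * \1_A d)); last first.
  by apply/funext => d; rewrite big_nat_recr.
split; first exact: (integrableD _ iW iwA).
rewrite big_nat_recr//= -eW /expect -/(Rintegral _ _ _) RintegralD//.
congr (_ + _); rewrite RintegralZl//; congr (_ * _).
have eA : (\int[mu M t]_d (\1_A d)%:E)%E = mu M t A.
  transitivity (mu M t (A `&` setT)); last by congr (mu M t _); exact: setIT.
  by apply: integral_indic => //; exact: measurable_itv.
rewrite /Rintegral eA /f /F subrK -fineB ?fin_num_measure//; congr fine.
have -> : A = `]-oo, z N%:Z]%classic `\` `]-oo, z (N%:Z - 1)]%classic.
  by rewrite /A; apply/seteqP; split=> x /=; rewrite !in_itv/=; [move=> /andP[h ->]; split=> //; rewrite leNgt h|move=> [-> /negP]; rewrite -ltNge => ->].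
rewrite measureD//; first by rewrite setIidr//; apply: subset_itvl; rewrite bnd_simp z_le// gerBl.
by rewrite -ge0_fin_numE// fin_num_measure.
Qed.

End Law.

(** * Descending induction, truncated sums, minimisers of coercive functions *)

Lemma descending_ind (P : nat -> Prop) n :
  P n -> (forall t, (t < n)%N -> P t.+1 -> P t) -> forall t, (t <= n)%N -> P t.
Proof.
move=> Pn IH t tn; rewrite -(subKn tn).
elim: (n - t)%N (leq_subr t n) => [|k IHk] kn; first by rewrite subn0.
apply: IH; first by lia.
by rewrite (_ : (n - k.+1).+1 = n - k)%N; [apply: IHk; lia|lia].
Qed.

Lemma sum_nat_tail0 (R : nmodType) (a : nat -> R) N N' :
  (forall k, (N <= k)%N -> a k = 0) -> (forall k, (N' <= k)%N -> a k = 0) ->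
  \sum_(0 <= k < N) a k = \sum_(0 <= k < N') a k.
Proof.
wlog NN' : N N' / (N <= N')%N.
  move=> h aN aN'; have [/h->//|/ltnW/h h'] := leqP N N'.
  by rewrite h'.
move=> aN _; rewrite [RHS](@big_cat_nat _ _ _ N)//= [X in _ = _ + X]big_nat_cond.
by rewrite [X in _ = _ + X]big1 ?addr0// => k /andP[/andP[/aN]].
Qed.

(** Coercivity confines the search to a compact interval, where the Lipschitz bound gives continuity
    and the extreme value theorem applies. For [g] equal to [C t], the second conclusion puts a
    genuine minimiser at or above [Cm]. *)
Lemma coercive_argmin (R : realType) (g : R -> R) (l : R) :
  (forall x y, `|g x - g y| <= l * `|x - y|) ->
  g y @[y --> +oo] --> +oo -> g y @[y --> -oo] --> +oo ->
  exists m, (forall x, g m <= g x) /\ inf [set y | forall x, g y <= g x] <= m.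
Proof.
move=> gl /cvgryPgt /(_ (g 0)) [b [_ gb]] /cvgryPgt /(_ (g 0)) [a [_ ga]].
pose r := `|a| + `|b| + 1.
have out x : (x < - r) || (r < x) -> g 0 < g x.
  move=> /orP[xr|xr]; [apply: ga|apply: gb]; rewrite /r in xr.
    have := ler_norm (- a); rewrite normrN; have := normr_ge0 b; lra.
  by have := ler_norm b; have := normr_ge0 a; lra.
have r0 : 0 <= r by rewrite /r; have := normr_ge0 b; have := normr_ge0 a; lra.
have cg : continuous g.
  move=> x; apply/cvgrPdist_lt => e e0.
  have l1 : 0 < `|l| + 1 by have := normr_ge0 l; lra.
  near=> y; apply: le_lt_trans (gl _ _) _.
  have : `|x - y| < e / (`|l| + 1).
    by near: y; apply: cvgr_dist_lt => //; rewrite divr_gt0.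
  rewrite ltr_pdivlMr// => h; apply: le_lt_trans h.
  by rewrite mulrC ler_wpM2l//; have := ler_norm l; lra.
have [||m mr mmin] := @EVT_min _ g (- r) r; first lra.
  exact: continuous_subspaceT.
have gm x : g m <= g x.
  have [xr|] := boolP (x \in `[- r, r]); first exact: mmin.
  rewrite in_itv/= negb_and -!ltNge => /out /ltW; apply: le_trans.
  by apply: mmin; rewrite in_itv/=; lra.
exists m; split=> //; apply: ge_inf => //.
exists (- r) => y /= /(_ 0) y0; rewrite leNgt; apply/negP => yr.
by have := out y; rewrite yr => /(_ isT); lra.
Unshelve. all: by end_near.
Qed.

(** * The backward recursions, restated stage by stage *)

Section Theory.
Variables (R : realType) (M : model R) (sTm1 : R) (gamma : nat -> R).
Local Notation T := (T M).
Local Notation al := (alpha M).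
Local Notation th := (theta M).
Local Notation K := (K M).
Local Notation z := (z M).
Local Notation f := (f M).
Local Notation C := (C M).
Local Notation H := (H M sTm1).
Local Notation S := (S M sTm1).
Local Notation s := (s M sTm1).
Local Notation Ibar := (Ibar M sTm1).
Local Notation V := (V M sTm1).
Local Notation A := (A M sTm1).
Local Notation eps := (eps M sTm1).
Local Notation phibar := (phibar M sTm1 gamma).
Local Notation psibar := (psibar M sTm1 gamma).
Local Notation epsbar := (epsbar M sTm1 gamma).

(** The point $I_t$ of the construction, which [stage] does not record. *)
Definition gridI (t : nat) : R :=
  gridmax M (fun x => x < Order.min (Ibar t.+1 - th) (Cm M t)).

Section Recurrences.
Variable t : nat.
Hypothesis tT : (t < T.-1)%N.

Let indexS : (T.-1 - t = (T.-1 - t.+1).+1)%N. Proof. lia. Qed.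
Let indexK : (T.-1 - (T.-1 - t.+1).+1 = t)%N. Proof. lia. Qed.

Lemma H_rec y :
  H t y = C t y + al * series_m1 (fun n => V t.+1 (y - z n) * f t n).
Proof. by rewrite /Defs.H /stage_at indexS /= indexK. Qed.

Lemma Ibar_rec :
  Ibar t = gridmax M (fun x => x <= gridI t /\ C t (gridI t) + K t < C t x) + th.
Proof. by rewrite /gridI /Defs.Ibar /stage_at indexS /= indexK. Qed.

Lemma S_rec : S t = gridmax M (fun x => gridI t <= x <= SU M t /\
  H t x = inf [set v | exists n, gridI t <= z n <= SU M t /\ v = H t (z n)]).
Proof. by rewrite /gridI /Defs.S /Defs.H /Defs.Ibar /stage_at indexS /= indexK. Qed.

Lemma s_rec : s t = if K t == 0 then S t
  else gridmin M (fun x => Ibar t <= x <= S t /\ H t x <= H t (S t) + K t).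
Proof. by rewrite /Defs.s /Defs.S /Defs.H /Defs.Ibar /stage_at indexS /= indexK. Qed.

Lemma eps_rec x : let y := if x < s t then S t else x in
  eps t x = al * A t.+1 y + al * expect M t (fun d => eps t.+1 (y - d)).
Proof. by rewrite /Defs.eps indexS /= indexK. Qed.

Lemma psibar_rec : psibar t = psi_of M sTm1 gamma t (phibar t.+1).
Proof. by rewrite /Defs.psibar ltn_eqF. Qed.

Lemma phibar_rec : phibar t = phi_of M sTm1 t (psibar t).
Proof. by rewrite psibar_rec /Defs.phibar indexS /= indexK. Qed.

End Recurrences.

Lemma stage_last : stage_at M sTm1 T.-1 = Stage (C T.-1) (Cm M T.-1) sTm1 sTm1.
Proof. by rewrite /stage_at subnn. Qed.

Lemma phibar_last x y :
  phibar T.-1 x y = if y < s T.-1 then 0 else gamma T.-1 * x.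
Proof. by rewrite /Defs.phibar subnn. Qed.

Lemma V_below t y : y < s t -> V t y = H t (S t) + K t.
Proof. by rewrite /Defs.V /Vof => ->. Qed.

Lemma V_above t y : s t <= y -> V t y = H t y.
Proof. by rewrite /Defs.V /Vof ltNge => ->. Qed.

Lemma phibar_below t x y : (t <= T.-1)%N -> y < s t -> phibar t x y = 0.
Proof.
rewrite leq_eqVlt => /predU1P[->|tT] ys; first by rewrite phibar_last ys.
by rewrite phibar_rec// /phi_of ys.
Qed.

(** * Standing assumptions, and the position of $s_t$ and $S_t$ *)

Hypothesis T2 : (2 <= T)%N.
Hypothesis al01 : 0 < al <= 1.
Hypothesis th0 : 0 < th.
Hypothesis mu_neg : forall t, (t < T)%N -> mu M t `]-oo, 0[%classic = 0%E.
Hypothesis cvxC : forall t, (t < T)%N -> forall x y l, 0 <= l <= 1 ->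
  C t (l * x + (1 - l) * y) <= l * C t x + (1 - l) * C t y.
Hypothesis Cpinfty : forall t, (t < T)%N -> C t y @[y --> +oo] --> +oo.
Hypothesis Cninfty : forall t, (t < T)%N -> C t y @[y --> -oo] --> +oo.
Hypothesis K_ge0 : forall t, (t < T)%N -> 0 <= K t.
Hypothesis C_sTm1 : C T.-1 sTm1 = C T.-1 (Cm M T.-1) + K T.-1.
Hypothesis intV : forall t x, (1 <= t <= T.-1)%N ->
  (mu M t.-1).-integrable setT (fun d => (V t (x - d))%:E).
Hypothesis inteps : forall t x, (t < T.-1)%N ->
  (mu M t).-integrable setT (fun d => (eps t.+1 (x - d))%:E).
Hypothesis gamma_ge0 : forall t, (t < T)%N -> 0 <= gamma t.
Hypothesis C_lip : forall t, (t < T)%N -> forall x y,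
  `|C t x - C t y| <= gamma t * `|x - y|.

Let al0 : 0 < al. Proof. by case/andP: al01. Qed.
Let ltT t : (t < T.-1)%N -> (t < T)%N. Proof. by move: T2; clear; lia. Qed.
Let leT t : (t <= T.-1)%N -> (t < T)%N. Proof. by move: T2; clear; lia. Qed.

(** Some minimiser [m] lies beyond [y], so [y] is a convex combination of [x] and [m], and [C t m]
    is at most [C t x]. *)
Lemma C_decreasing t x y : (t < T)%N -> x <= y -> y < Cm M t -> C t y <= C t x.
Proof.
move=> tT xy yCm.
have [m [mmin Cmm]] := coercive_argmin (C_lip tT) (Cpinfty tT) (Cninfty tT).
have ym : y < m := lt_le_trans yCm Cmm.
have xm : 0 < m - x by rewrite subr_gt0 (le_lt_trans xy).
pose l := (m - y) / (m - x).
have l01 : 0 <= l <= 1.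
  by rewrite /l ler_pdivrMr// divr_ge0 ?(ltW xm) ?subr_ge0 ?(ltW ym)//= mul1r lerB.
have := cvxC tT x m l01.
have -> : l * x + (1 - l) * m = y by rewrite /l; field; lra.
move/le_trans; apply; have := mmin x; nra.
Qed.

Lemma series_V t y N : (t < T.-1)%N -> y - z (N%:Z - 1) < s t.+1 ->
  let c := H t.+1 (S t.+1) + K t.+1 in
  series_m1 (fun n => V t.+1 (y - z n) * f t n) =
  c + \sum_(0 <= k < N) (V t.+1 (y - z (k%:Z - 1)) - c) * f t (k%:Z - 1).
Proof.
move=> tT yN c.
apply: (series_evconst th0 (mu_neg (ltT tT)) (v := fun n => V t.+1 (y - z n))) => k Nk.
rewrite V_below//; apply: le_lt_trans yN.
by rewrite lerD2l lerN2 z_le//; move: Nk; clear; lia.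
Qed.

(** The smallest grid demand is [z (-1) = - theta], so the largest argument of [V t.+1] in [H t x]
    is [x + theta]; if it is below [s t.+1], the series reduces to a constant. *)
Lemma H_diff_below t x y : (t < T.-1)%N -> x + th < s t.+1 -> y + th < s t.+1 ->
  H t x - H t y = C t x - C t y.
Proof.
move=> tT xs ys.
have e u : u + th < s t.+1 -> u - z (0%N%:Z - 1) < s t.+1.
  by rewrite zB z1 z0 sub0r opprK.
by rewrite !H_rec// !(series_V tT (e _ _))// !big_nil; ring.
Qed.

(** The first conclusion is the induction invariant. All are read off the same extremal grid points:
    [z i] is $I_t$, [z p] is $\bar I_t-\theta$, [z u] is $S^U_t$, [z a] is $S_t$ and, when [K t] is
    nonzero, [z b] is $s_t$. *)
Lemma stage_facts t : (t < T.-1)%N -> Ibar t.+1 <= s t.+1 ->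
  [/\ Ibar t <= s t, exists b, s t = z b, exists a, S t = z a &
      H t (S t) + K t <= H t (s t - th)].
Proof.
move=> tT Is; have K0 := K_ge0 (ltT tT).
have zlow x : exists m, z m < x.
  have [m /andP[+ _]] := z_ceil th0 x; by exists (m - 1).
have [||i [Ii + _]] := gridmaxP th0 (P := fun x => x < Order.min (Ibar t.+1 - th) (Cm M t)).
- exact: zlow.
- by exists (Order.min (Ibar t.+1 - th) (Cm M t)) => m /ltW.
rewrite -/(gridI t) in Ii; rewrite lt_min => /andP[iIbar iCm].
have [||p [Ip [pi Cp] _]] := gridmaxP th0 (P := fun x => x <= z i /\ C t (z i) + K t < C t x).
- have /cvgryPgt/(_ (C t (z i) + K t))[a [_ Ca]] := Cninfty (ltT tT).
  have [m] := zlow (Order.min a (z i)); rewrite lt_min => /andP[ma mi].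
  by exists m; split; [exact: ltW|exact: Ca].
- by exists (z i) => m [].
have IbE : Ibar t = z (p + 1) by rewrite Ibar_rec// Ii Ip zD z1.
rewrite z_le// in pi.
(* [p = i] would give [C t (z i) + K t < C t (z i)], against [0 <= K t]. *)
have pi' : p + 1 <= i.
  by have : p != i; [apply/eqP => pE; rewrite pE in Cp; lra|move: pi; clear; lia].
have [||u [Iu [uCm _] _]] := gridminP th0 (P := fun x => Cm M t <= x /\ C t (zn0 M t) + K t < C t x).
- have /cvgryPgt/(_ (C t (zn0 M t) + K t))[a [_ Ca]] := Cpinfty (ltT tT).
  have [N /(_ N%:Z (lexx _))] := z_unbounded th0 (Order.max a (Cm M t)).
  by rewrite gt_max => /andP[aN CN]; exists N; split; [exact: ltW|exact: Ca].
- by exists (Cm M t) => m [].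
rewrite -/(SU M t) in Iu.
have iu : i <= u by rewrite -(z_le th0) (le_trans (ltW iCm)).
have [a [Sa [ia au amin]]] := grid_argmax_argmin th0 (H t) iu.
have SE : S t = z a by rewrite S_rec// Ii Iu.
have below n : n <= i -> z n + th < s t.+1.
  rewrite -(z_le th0) => ni; have : z n < Ibar t.+1 - th := le_lt_trans ni iIbar.
  lra.
have HS_le_Hi : H t (S t) <= H t (z i) by rewrite SE amin// lexx.
rewrite s_rec//; have [K00|Kn0] := eqVneq (K t) 0.
  have i1i : i - 1 <= i by clear; lia.
  rewrite SE IbE K00 addr0 z_le// -z1 -zB; split; [by move: pi' ia; clear; lia|by exists a|by exists a|].
  (* If $S_t-\theta\ge I_t$, that point competes in the minimisation. Otherwise $S_t=I_t$, and the
     comparison reduces to that of [C t], nonincreasing below [Cm]. *)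
  have [ia'|ia'] := leP i (a - 1); first by apply: amin; move: ia' au; clear; lia.
  have -> : a = i by move: ia ia'; clear; lia.
  have := H_diff_below tT (below (i - 1) _) (below i (lexx _)) => /(_ i1i).
  by have := @C_decreasing t (z (i - 1)) (z i) (ltT tT); rewrite z_le// => /(_ i1i iCm); lra.
have [||b [Ib [/andP[Ibb bS] Hb] bmin]] := gridminP th0
    (P := fun x => Ibar t <= x <= S t /\ H t x <= H t (S t) + K t).
- by exists a; rewrite -SE lexx lerDl SE IbE z_le//; split=> //; move: pi' ia; clear; lia.
- by exists (Ibar t) => m [/andP[]].
rewrite Ib -z1 -zB; split; [by []|by exists b|by exists a|].
rewrite leNgt; apply/negP => Hb1.
(* Minimality of [b] excludes $s_t-\theta\ge\bar I_t$. Otherwise $s_t-\theta$ is [z p], where [C t],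
   hence [H t], exceeds its value at $I_t$ by more than [K t], while $H_t(I_t)\ge H_t(S_t)$. *)
have [Ib1|Ib1] := leP (Ibar t) (z (b - 1)).
  have /bmin : Ibar t <= z (b - 1) <= S t /\ H t (z (b - 1)) <= H t (S t) + K t.
    by rewrite Ib1 (ltW Hb1) (le_trans _ bS)// z_le//; clear; lia.
  by clear; lia.
rewrite IbE z_le// in Ibb; rewrite IbE z_lt// in Ib1.
have bp : b - 1 = p by move: Ibb Ib1; clear; lia.
have := H_diff_below tT (below p _) (below i (lexx _)) => /(_ pi).
rewrite bp in Hb1; lra.
Qed.

Lemma Ibar_le_s t : (t <= T.-1)%N -> Ibar t <= s t.
Proof.
move: t; apply: descending_ind; first by rewrite /Defs.Ibar /Defs.s stage_last.
by move=> t tT /(stage_facts tT)[].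
Qed.

Lemma s_grid t : (t < T.-1)%N -> exists b, s t = z b.
Proof. by move=> tT; have [] := stage_facts tT (Ibar_le_s tT). Qed.

Lemma S_grid t : (t < T.-1)%N -> exists a, S t = z a.
Proof. by move=> tT; have [] := stage_facts tT (Ibar_le_s tT). Qed.

Lemma reorder_cost_le t : (t < T.-1)%N -> H t (S t) + K t <= H t (s t - th).
Proof. by move=> tT; have [] := stage_facts tT (Ibar_le_s tT). Qed.

(** * The upper estimate functions on the grid *)

Lemma psibar_sum t (j : int) N : (t < T.-1)%N -> z j - z (N%:Z - 1) < s t.+1 ->
  psibar t th (z j) = gamma t * th +
    al * \sum_(0 <= k < N) phibar t.+1 th (z (j - (k%:Z - 1))) * f t (k%:Z - 1).
Proof.
move=> tT jN.
(* [phibar t.+1] vanishes below [s t.+1], so the number of terms prescribed by [psi_of] may be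
   replaced by any large enough [N]; several values of [j] can then share one [N]. *)
have tail0 (k : nat) n : n <= k%:Z -> z j - z (n - 1) < s t.+1 ->
    phibar t.+1 th (z (j - (k%:Z - 1))) * f t (k%:Z - 1) = 0.
  move=> nk jn; rewrite phibar_below ?mul0r// zB; apply: le_lt_trans jn.
  by rewrite lerD2l lerN2 z_le//; move: nk; clear; lia.
rewrite psibar_rec// /psi_of; case: ltP => [js|sj].
  rewrite big_nat_cond big1 ?mulr0 ?addr0// => k _.
  by apply: (tail0 k 0) => //; rewrite zB z1 z0; lra.
set m := Num.floor _; congr (_ + _ * _).
(* In this branch [z j - s t.+1 >= - theta], so [absz] in [psi_of] acts on a nonnegative integer. *)
have m0 : -1 <= m by rewrite floor_ge_int ler_pdivlMr//; lra.
have jm : z j - z (m + 1) < s t.+1.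
  have := floorD1_gt ((z j - s t.+1) / th); rewrite -/m ltr_pdivrMr//.
  by rewrite mulrC -/(z _); lra.
under eq_bigr do rewrite -zB.
apply: sum_nat_tail0 => k kN; last by apply: (tail0 k N%:Z) => //; move: kN; clear; lia.
apply: (tail0 k (m + 1 + 1)); last by rewrite addrK.
by move: kN m0; clear; lia.
Qed.

(** The middle case of [phi_of] requires [s t <= z j < s t + theta], which on the grid forces
    [z j = s t]; its first argument is then [theta]. *)
Lemma phibar_grid t (j : int) : (t < T.-1)%N ->
  phibar t th (z j) = if z j < s t then 0 else psibar t th (z j).
Proof.
move=> tT; rewrite phibar_rec// /phi_of; case: ltP => // sj; case: ltP => // js.
have [b sb] := s_grid tT.
have jb : j = b.
  move: sj js; rewrite sb -z1 -zB z_le// z_lt//; clear; lia.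
by rewrite sb jb subrr add0r.
Qed.

Lemma grid_far t (j : int) : exists N : nat, z j - z (N%:Z - 1) < s t.
Proof.
have [N jN] := z_unbounded th0 (z j - s t).
exists N.+1; have := jN (N.+1%:Z - 1); rewrite lerBrDr => /(_ ltac:(clear; lia)); lra.
Qed.

(** The two properties go together: [phibar] passes from 0 to [psibar] at $s_t$, so monotonicity
    across that point rests on nonnegativity. *)
Lemma phibar_ge0_mono t : (t <= T.-1)%N ->
  (forall j, 0 <= phibar t th (z j)) /\
  (forall j j', j <= j' -> phibar t th (z j) <= phibar t th (z j')).
Proof.
move: t; apply: descending_ind => [|t tT [ge0 mono]].
  have gth : 0 <= gamma T.-1 * th by rewrite mulr_ge0 ?(ltW th0)// gamma_ge0// leT.
  split=> [j|j j' jj']; rewrite !phibar_last; first by case: ifP.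
  case: ltP => js; first by case: ifP.
  by rewrite ltNge (le_trans js) ?z_le.
have gth : 0 <= gamma t * th by rewrite mulr_ge0 ?(ltW th0)// gamma_ge0// ltT.
have f0 n : 0 <= f t n by exact: f_ge0.
have psi_ge0 j : 0 <= psibar t th (z j).
  have [N jN] := grid_far t.+1 j; rewrite (psibar_sum tT jN).
  by rewrite addr_ge0// mulr_ge0 ?(ltW al0)// sumr_ge0// => k _; rewrite mulr_ge0.
split=> [j|j j' jj']; rewrite !phibar_grid//; first by case: ifP.
case: (ltP (z j)) => js; first by case: ifP.
have sj' : s t <= z j' by rewrite (le_trans js)// z_le.
rewrite ltNge sj'/=.
have [N jN] := grid_far t.+1 j'; rewrite (psibar_sum tT jN) (psibar_sum (N := N) tT); last first.
  by apply: le_lt_trans jN; rewrite lerD2r z_le.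
rewrite lerD2l ler_pM2l//; apply: ler_sum => k _; apply: ler_wpM2r => //.
by apply: mono; rewrite lerD2r.
Qed.

Lemma phibar_ge0 t j : (t <= T.-1)%N -> 0 <= phibar t th (z j).
Proof. by move=> /phibar_ge0_mono[]. Qed.

Lemma psibar_mono t j j' : (t < T.-1)%N -> j <= j' ->
  psibar t th (z j) <= psibar t th (z j').
Proof.
move=> tT jj'; have [N jN] := grid_far t.+1 j'.
rewrite (psibar_sum tT jN) (psibar_sum (N := N) tT); last first.
  by apply: le_lt_trans jN; rewrite lerD2r z_le.
have [_ mono] := phibar_ge0_mono tT.
rewrite lerD2l ler_pM2l//; apply: ler_sum => k _; apply: ler_wpM2r.
  exact: f_ge0.
by apply: mono; rewrite lerD2r.
Qed.

(** * Cost increase when the inventory drops *)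

Lemma C_drop t x y : (t < T)%N -> x <= y -> C t x - C t y <= gamma t * (y - x).
Proof.
move=> tT xy; apply: le_trans (ler_norm _) _; apply: le_trans (C_lip tT _ _) _.
by rewrite distrC ger0_norm// subr_ge0.
Qed.

(** The equation for [sTm1] makes the plateau value equal to [C] at $s_{T-1}$, so a drop ending
    below $s_{T-1}$ costs only what the drop to $s_{T-1}$ costs. This stage is treated apart since
    $s_{T-1}$ need not be a grid point. *)
Lemma V_last_drop x y d : x <= y -> y - x <= d ->
  V T.-1 x - V T.-1 y <= if y < s T.-1 then 0 else gamma T.-1 * d.
Proof.
move=> xy yxd; have lT := leT (leqnn T.-1).
have drop u v : u <= v -> v - u <= d -> C T.-1 u - C T.-1 v <= gamma T.-1 * d.
  by move=> uv vud; apply: le_trans (C_drop lT uv) _; rewrite ler_wpM2l// gamma_ge0.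
have HE : H T.-1 = C T.-1 by rewrite /Defs.H stage_last.
case: ltP => ys; first by rewrite !V_below ?subrr// (le_lt_trans xy).
rewrite (V_above ys) HE; have [xs|sx] := ltP x (s T.-1); last first.
  by rewrite V_above// HE drop.
rewrite V_below// HE.
have -> : S T.-1 = Cm M T.-1 by rewrite /Defs.S stage_last.
have sE : s T.-1 = sTm1 by rewrite /Defs.s stage_last.
by rewrite -C_sTm1 -sE drop//; lra.
Qed.

(* A drop of up to [2 * theta] is allowed because, when [y'] is below [s t],
   it is replaced by [s t - theta]. *)
Lemma H_drop t (j : int) y' y : (t < T.-1)%N ->
  (forall j y' y, z (j - 2) <= y' -> y' <= y -> y <= z j ->
    V t.+1 y' - V t.+1 y <= 2 * phibar t.+1 th (z j)) ->
  z (j - 2) <= y' -> y' <= y -> y <= z j ->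
  H t y' - H t y <= 2 * psibar t th (z j).
Proof.
move=> tT Vdrop jy y'y yj.
have [N jN] := grid_far t.+1 j.
have yN : y - z (N%:Z - 1) < s t.+1 by lra.
have y'N : y' - z (N%:Z - 1) < s t.+1 by lra.
rewrite !H_rec// (series_V tT yN) (series_V tT y'N) (psibar_sum tT jN).
set c := H t.+1 _ + _.
have Cd : C t y' - C t y <= 2 * (gamma t * th).
  apply: le_trans (C_drop (ltT tT) y'y) _.
  rewrite mulrCA ler_wpM2l ?gamma_ge0 ?ltT//.
  by move: jy; rewrite zB (zD M 1 1) z1; lra.
(* Subtracting the same grid demand from both inventories shifts the window to that of
   [j - (k - 1)], so [Vdrop] bounds each term. *)
suff : \sum_(0 <= k < N) (V t.+1 (y' - z (k%:Z - 1)) - c) * f t (k%:Z - 1) -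
       \sum_(0 <= k < N) (V t.+1 (y - z (k%:Z - 1)) - c) * f t (k%:Z - 1) <=
       2 * \sum_(0 <= k < N) phibar t.+1 th (z (j - (k%:Z - 1))) * f t (k%:Z - 1).
  by move/(ler_wpM2l (ltW al0)); lra.
rewrite -sumrB mulr_sumr; apply: ler_sum => k _.
rewrite -mulrBl mulrA; apply: ler_wpM2r; first exact: f_ge0.
rewrite opprB addrA addrNK; apply: Vdrop.
- by rewrite (addrAC j) (zB _ (j - 2)) lerD2r.
- by rewrite lerD2r.
- by rewrite (zB _ j) lerD2r.
Qed.

Lemma V_drop t (j : int) y' y : (t <= T.-1)%N ->
  z (j - 2) <= y' -> y' <= y -> y <= z j ->
  V t y' - V t y <= 2 * phibar t th (z j).
Proof.
move=> tT1; move: t tT1 j y' y.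
apply: descending_ind => [|t tT IH] j y' y jy y'y yj.
  have y'y2 : y - y' <= 2 * th by move: jy; rewrite zB (zD M 1 1) z1; lra.
  have gth : 0 <= gamma T.-1 * th by rewrite mulr_ge0 ?(ltW th0)// gamma_ge0// leT.
  have := V_last_drop y'y y'y2; rewrite phibar_last; case: ltP => ys.
    by move/le_trans; apply; rewrite mulr_ge0//; case: ifP.
  by rewrite ltNge (le_trans ys yj)/= [gamma _ * (2 * _)]mulrCA.
have [ys|sy] := ltP y (s t).
  by rewrite !V_below ?subrr ?mulr_ge0 ?phibar_ge0 ?(ltnW tT)// (le_lt_trans y'y).
rewrite phibar_grid// ltNge (le_trans sy yj)/= (V_above sy).
have [y's|sy'] := ltP y' (s t); last by rewrite V_above// (H_drop tT IH).
rewrite V_below//; apply: (@le_trans _ _ (H t (s t - th) - H t y)).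
  by rewrite lerD2r reorder_cost_le.
apply: (H_drop tT IH) => //; last by rewrite lerBlDr (le_trans sy)// lerDl ltW.
(* The grid point [z (j - 2)] is below the grid point [s t], hence at most [s t - theta]: the
   replacement stays in the window. *)
have [b sb] := s_grid tT; have := le_lt_trans jy y's.
by rewrite sb -z1 -zB z_lt// z_le//; clear; lia.
Qed.

(** * The error of rounding demand to the grid *)

Lemma sum_grid_indic (w : nat -> R) N (k : nat) d : z (k%:Z - 1) < d <= z k%:Z ->
  \sum_(0 <= i < N) w i * \1_(`]z (i%:Z - 1), z i%:Z]%classic) d =
  if (k < N)%N then w k else 0.
Proof.
move=> /andP[kd dk].
rewrite (eq_bigr (fun i => if i == k then w i else 0)); last first.
  move=> i _; rewrite indicE mem_setE in_itv/=; case: eqVneq => [->|ik].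
    by rewrite kd dk mulr1.
  case: andP => [[di id]|]; last by rewrite mulr0.
  have := lt_le_trans kd id; have := lt_le_trans di dk.
  by rewrite !z_lt//; move: ik; clear; lia.
by rewrite -big_mkcond big_nat1_eq.
Qed.

(** A demand in the cell from [z (k - 1)] to [z k] is counted as [z (k - 1)]. The step function
    equal to [V t.+1 (y - z (k - 1)) + w k] on the first [N] cells and to the reorder cost elsewhere
    dominates [V t.+1 (y - d)] for [d >= 0]; its expectation minus the series is the bound. *)
Lemma A_le t y N (w : nat -> R) : (t < T.-1)%N -> y - z (N%:Z - 1) < s t.+1 ->
  (forall (k : nat) d, z (k%:Z - 1) < d -> d <= z k%:Z ->
     V t.+1 (y - d) - V t.+1 (y - z (k%:Z - 1)) <= w k) ->
  A t.+1 y <= \sum_(0 <= k < N) w k * f t (k%:Z - 1).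
Proof.
move=> tT yN wV; rewrite /Defs.A (series_V tT yN)/=; set c := H t.+1 _ + _.
pose u k := V t.+1 (y - z (k%:Z - 1)) - c + w k.
have [iW eW] := expect_step th0 t u N.
have ic : (mu M t).-integrable setT (EFin \o (fun=> c)).
  exact: finite_measure_integrable_cst.
have iV : (mu M t).-integrable setT (EFin \o (fun d => V t.+1 (y - d))).
  exact: (intV y (t := t.+1)).
have -> : \sum_(0 <= k < N) w k * f t (k%:Z - 1) = expect M t (fun d => c +
    \sum_(0 <= k < N) u k * \1_(`]z (k%:Z - 1), z k%:Z]%classic) d) -
   (c + \sum_(0 <= k < N) (V t.+1 (y - z (k%:Z - 1)) - c) * f t (k%:Z - 1)).
  have -> : expect M t (fun d => c +
      \sum_(0 <= k < N) u k * \1_(`]z (k%:Z - 1), z k%:Z]%classic) d) =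
      expect M t (fun=> c) + expect M t (fun d =>
      \sum_(0 <= k < N) u k * \1_(`]z (k%:Z - 1), z k%:Z]%classic) d).
    exact: (RintegralD _ ic iW).
  rewrite expect_cst eW [c + _ in X in X - _]addrC addrKA -sumrB; apply: eq_bigr => k _.
  by rewrite /u; ring.
rewrite lerD2r; apply: expect_le => //.
- exact: mu_neg (ltT tT).
- exact: (integrableD _ ic iW).
move=> d d0; have [m /andP[md dm]] := z_ceil th0 d.
have m0 : 0 <= m by rewrite -(z_le th0) z0 (le_trans d0).
have mE : m = `|m|%N by rewrite gez0_abs.
rewrite mE in md dm; rewrite (sum_grid_indic _ _ (k := `|m|%N)) ?md//.
case: ltnP => [mN|Nm].
  by have := wV _ _ md dm; rewrite /u; lra.
rewrite addr0 V_below//; apply: le_lt_trans yN.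
rewrite lerD2l lerN2; apply: le_trans (ltW md).
by rewrite z_le//; move: Nm; clear; lia.
Qed.

Lemma A_le_psibar t (j : int) y : (t < T.-1)%N -> z (j - 1) <= y -> y <= z j ->
  al * A t.+1 y <= 2 * (psibar t th (z j) - gamma t * th).
Proof.
move=> tT jy yj; have [N jN] := grid_far t.+1 j.
rewrite (psibar_sum tT jN) addrAC subrr add0r mulrCA ler_pM2l// mulr_sumr.
under eq_bigr do rewrite mulrA.
apply: A_le => //; first lra.
move=> k d kd dk; apply: V_drop => //; first 1 last.
- lra.
- by rewrite (zB _ j); lra.
(* The lower end of the window comes from [z (j - 1) <= y] and [d <= z k]. *)
rewrite (_ : j - _ - 2 = j - 1 - k%:Z); last by clear; lia.
by rewrite (zB _ (j - 1)); lra.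
Qed.

(** At the last stage, rounding within one cell costs at most [gamma T.-1 * theta] whatever the
    inventory, and the total mass of the cells is at most 1. *)
Lemma A_last_le y : A T.-1 y <= gamma T.-1 * th.
Proof.
have tT : (T.-2 < T.-1)%N by move: T2; clear; lia.
have e : T.-2.+1 = T.-1 by move: T2; clear; lia.
have [m /andP[_ ym]] := z_ceil th0 y.
have [N mN] := grid_far T.-1 m.
have gth : 0 <= gamma T.-1 * th by rewrite mulr_ge0 ?(ltW th0)// gamma_ge0// leT.
have := @A_le T.-2 y N (fun=> gamma T.-1 * th) tT; rewrite e => /(_ ltac:(lra)).
move=> /(_ _)/le_trans; apply.
  move=> k d kd dk; have kth : z k%:Z = z (k%:Z - 1) + th by rewrite -z1 -zD subrK.
  have := @V_last_drop (y - d) (y - z (k%:Z - 1)) th => /(_ ltac:(lra) ltac:(lra)).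
  by move/le_trans; apply; case: ifP.
rewrite -mulr_sumr sum_f//; last exact: mu_neg (ltT tT).
by rewrite ler_piMr// F_le1.
Qed.

(** * The recursion for [epsbar] and the final bound *)

Lemma lam_shift t zk i :
  lam M sTm1 t zk i.+1 = lam M sTm1 t.+1 (Order.max zk (S t) + th) i.
Proof.
elim: i => [|i IH]; first by rewrite /= addn0.
by rewrite -[LHS]/(Order.max (lam M sTm1 t zk i.+1) _ + th) IH addnS.
Qed.

Lemma epsbar_last zk : epsbar (T - 2) zk = al * gamma T.-1 * th.
Proof. by rewrite /Defs.epsbar eqxx. Qed.

(** Splitting off [i = 0] and reindexing by [lam_shift] gives the closed form the shape of
    [eps_rec], ready for descending induction. *)
Lemma epsbar_rec t zk : (t < T - 2)%N -> epsbar t zk =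
  2 * (psibar t th (Order.max zk (S t)) - gamma t * th) +
  al * epsbar t.+1 (Order.max zk (S t) + th).
Proof.
move=> tT; rewrite [in LHS]/Defs.epsbar ltn_eqF//.
have -> : (T - 2 - t = (T - 2 - t.+1).+1)%N by move: tT; clear; lia.
rewrite big_nat_recl// /= addn0 expr0 mulr1.
rewrite (_ : T.-1 - t = (T.-1 - t.+1).+1)%N; last by move: tT; clear; lia.
(* When [t.+1] is [T - 2], the separate form of [epsbar] agrees with the general one with an empty
   sum. *)
rewrite /Defs.epsbar; case: eqVneq => [tE|_].
  rewrite tE subnn big_geq// addr0 (_ : T.-1 - (T - 2) = 1)%N; last by move: T2; clear; lia.
  by ring.
rewrite [al * (_ + _)]mulrDr mulr_sumr addrCA; congr (_ + (_ + _)); first by rewrite exprS !mulrA.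
apply: eq_bigr => i _.
rewrite -[Order.max (lam _ _ _ _ i) _ + th]/(lam M sTm1 t zk i.+1) lam_shift addnS addSn.
by rewrite exprS; ring.
Qed.

Lemma max_S_grid t (j : int) : (t < T.-1)%N ->
  exists m, [/\ Order.max (z j) (S t) = z m, j <= m, S t <= z m &
                forall n, z j <= z n -> S t <= z n -> m <= n].
Proof.
move=> tT; have [a Sa] := S_grid tT.
rewrite Sa; case: (leP (z j) (z a)) => h; [exists a|exists j]; split=> //.
- by rewrite -(z_le th0).
- by move=> n _; rewrite z_le.
- exact: ltW.
- by move=> n; rewrite z_le.
Qed.

Lemma epsbar_mono t (j j' : int) : (t <= T - 2)%N -> j <= j' ->
  epsbar t (z j) <= epsbar t (z j').
Proof.
move=> tT2; move: t tT2 j j'; apply: descending_ind => [|t tT2 IH] j j' jj'.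
  by rewrite !epsbar_last.
have tT : (t < T.-1)%N by move: tT2; clear; lia.
have [m [mE jm Sm mmin]] := max_S_grid j tT.
have [m' [m'E jm' Sm' _]] := max_S_grid j' tT.
have mm' : m <= m' by apply: mmin => //; rewrite z_le// (le_trans jj').
have zS n : z n + th = z (n + 1) by rewrite zD z1.
rewrite !(epsbar_rec _ tT2) mE m'E !zS lerD//.
  by rewrite ler_pM2l// lerD2r psibar_mono.
by rewrite ler_pM2l// IH// lerD2r.
Qed.

Lemma eps_le_epsbar t : (t <= T - 2)%N -> forall (j : int) x,
  z (j - 1) < x -> x <= z j -> eps t x <= epsbar t (z j).
Proof.
move: t; apply: descending_ind => [|t tT2 IH] j x jx xj.
  have tT : (T - 2 < T.-1)%N by move: T2; clear; lia.
  have e : ((T - 2).+1 = T.-1)%N by move: T2; clear; lia.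
  rewrite epsbar_last eps_rec// e (_ : (fun d => _) = fun=> 0); last first.
    by apply/funext => d; rewrite /Defs.eps subnn.
  by rewrite expect_cst mulr0 addr0 -mulrA ler_pM2l// A_last_le.
have tT : (t < T.-1)%N by move: tT2; clear; lia.
have [m [mE jm Sm _]] := max_S_grid j tT.
rewrite (eps_rec tT) (epsbar_rec _ tT2) mE; set y := if _ then _ else _.
(* After reordering, [y] is [S t], itself a grid point; otherwise [y] is [x], in the cell of [j].
   Either cell lies at or below [z m]. *)
have [j' [j'm j'y yj']] : exists j', [/\ j' <= m, z (j' - 1) <= y & y <= z j'].
  rewrite /y; case: ifP => _; last by exists j; split=> //; exact: ltW.
  have [a Sa] := S_grid tT; exists a.
  by rewrite Sa z_le// gerBl ler01 lexx; split=> //; rewrite -(z_le th0) -Sa.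
apply: lerD.
  apply: le_trans (A_le_psibar tT j'y yj') _.
  by rewrite ler_pM2l// lerD2r psibar_mono.
rewrite ler_pM2l// -[leRHS](expect_cst M t); apply: expect_le => //.
- exact: mu_neg (ltT tT).
- exact: inteps.
- exact: finite_measure_integrable_cst.
(* A nonnegative demand leaves [y - d] at most [z m], so its cell index is at most [m + 1], and
   monotonicity gives one bound for all demands. *)
move=> d d0; have [n /andP[nd dn]] := z_ceil th0 (y - d).
apply: le_trans (IH _ _ nd dn) _.
rewrite (_ : z m + th = z (m + 1)); last by rewrite zD z1.
apply: epsbar_mono.
  by move: tT2; clear; lia.
have : z (n - 1) < z m.
  by apply: lt_le_trans nd _; rewrite lerBlDr (le_trans yj')// ler_wpDr// z_le.
by rewrite z_lt//; clear; lia.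
Qed.

End Theory.

Theorem theorem4p4 (R : realType) (M : model R) (sTm1 : R) (gamma : nat -> R) :
  (2 <= T M)%N ->
  0 < alpha M <= 1 ->
  0 < theta M ->
  (* demands are nonnegative with finite mean *)
  (forall t, (t < T M)%N -> mu M t `]-oo, 0[%classic = 0%E) ->
  (forall t, (t < T M)%N -> (mu M t).-integrable setT (fun d : R => d%:E)) ->
  (* standing assumption (i): C_t convex and C_t(y) -> +oo as |y| -> oo *)
  (forall t, (t < T M)%N -> forall x y l, 0 <= l <= 1 ->
     C M t (l * x + (1 - l) * y) <= l * C M t x + (1 - l) * C M t y) ->
  (forall t, (t < T M)%N -> C M t y @[y --> +oo] --> +oo) ->
  (forall t, (t < T M)%N -> C M t y @[y --> -oo] --> +oo) ->
  (* setup costs: K_t >= 0 and (ii) K_t >= alpha K_{t+1} *)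
  (forall t, (t < T M)%N -> 0 <= K M t) ->
  (forall t, (t < (T M).-1)%N -> alpha M * K M t.+1 <= K M t) ->
  (* the point s_{T-1} *)
  sTm1 <= Cm M (T M).-1 ->
  C M (T M).-1 sTm1 = C M (T M).-1 (Cm M (T M).-1) + K M (T M).-1 ->
  (* all expectations appearing are finite *)
  (forall t x, (1 <= t <= (T M).-1)%N ->
     (mu M t.-1).-integrable setT (fun d => (V M sTm1 t (x - d))%:E)) ->
  (forall t x, (t < (T M).-1)%N ->
     (mu M t).-integrable setT (fun d => (eps M sTm1 t.+1 (x - d))%:E)) ->
  (* Lipschitz constants *)
  (forall t, (t < T M)%N -> 0 <= gamma t) ->
  (forall t, (t < T M)%N -> forall x y, `|C M t x - C M t y| <= gamma t * `|x - y|) ->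
  forall t, (t <= T M - 2)%N ->
  forall (k : int) (x : R), z M (k - 1) < x <= z M k ->
    eps M sTm1 t x <= epsbar M sTm1 gamma t (z M k).
Proof.
move=> T2 al01 th0 mu_neg _ cvxC Cp Cn K0 _ _ CsT intV inteps g0 Clip t tT k x.
by case/andP; exact: eps_le_epsbar.
Qed.
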